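(* Let $b\geq 4$ be an integer and let $G$ be a finite simple graph with minimum degree $\delta\geq 1$ and independence number $\alpha$ such that $\alpha>\frac{b(\delta-1)}{2}$. Then $G$ possesses a pseudo $[2,b]$-factor with at most $\alpha-\lfloor\frac{b}{2}(\delta-1)\rfloor$ components that are edges or vertices.
   Context: A factor of a graph $G$ is a spanning subgraph of $G$ (obtained by deleting edges only). For an integer $b\geq 2$, a pseudo $[2,b]$-factor of $G$ is a factor of $G$ in which every connected component $C$ having at least three vertices satisfies $2\leq d_C(x)\leq b$ for every vertex $x$ of $C$, where $d_C(x)$ is the degree of $x$ in $C$. Hence each component of a pseudo $[2,b]$-factor is either a single vertex, a single edge ($K_2$), or a connected subgraph on at least three vertices with all degrees between $2$ and $b$. The independence number $\alpha$ is the maximum size of a set of pairwise non-adjacent vertices of $G$. *)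

(* Defs.v *)
From mathcomp Require Import all_boot.

Set Implicit Arguments.
Unset Strict Implicit.
Unset Printing Implicit Defensive.

(* A finite simple graph is a finite vertex type T with an adjacency relation. *)
Definition simple_graph (T : finType) (e : rel T) : Prop :=
  symmetric e /\ irreflexive e.

(* Degree of x in the subgraph induced by A; d_C(x) when C is a component. *)
Definition degree_in (T : finType) (e : rel T) (A : {set T}) (x : T) : nat :=
  #|[set y in A | e x y]|.

Definition degree (T : finType) (e : rel T) (x : T) : nat :=
  degree_in e [set: T] x.

(* Degrees never exceed #|T|, so the default value #|T| is neutral on a
   nonempty graph; the graph without vertices gets minimum degree 0. *)
Definition min_degree (T : finType) (e : rel T) : nat :=
  \big[minn/#|T|]_(x : T) degree e x.

Definition independent (T : finType) (e : rel T) (A : {set T}) : bool :=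
  [forall x in A, forall y in A, ~~ e x y].

Definition independence_number (T : finType) (e : rel T) : nat :=
  \max_(A : {set T} | independent e A) #|A|.

(* A spanning subgraph: same vertex type, fewer edges. *)
Definition factor (T : finType) (e f : rel T) : Prop :=
  simple_graph f /\ subrel f e.

(* Vertex sets of the connected components; the component itself is the
   subgraph induced on such a set. *)
Definition components (T : finType) (f : rel T) : {set {set T}} :=
  equivalence_partition (connect f) [set: T].

Definition pseudo_2b_factor (T : finType) (b : nat) (e f : rel T) : Prop :=
  factor e f /\
  (forall C : {set T}, C \in components f -> 3 <= #|C| ->
     forall x : T, x \in C -> 2 <= degree_in f C x <= b).

(* A component is a vertex or an edge exactly when it has at most two
   vertices, a connected simple graph on two vertices being K_2. *)
Definition trivial_components (T : finType) (f : rel T) : {set {set T}} :=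
  [set C in components f | #|C| <= 2].

(* Main.v *)
Require Import Defs.
From mathcomp Require Import all_boot zify.
From Stdlib Require Import Classical.

(* Call X full if it carries a subgraph of G with all degrees in [2, b], and
   near-full if it carries one with a single exception t, of degree 1.  Let W be
   a full set of maximum size and let X be a near-full set of maximum size, with
   subgraph F, supposing that |X| > |W|.  Alternating paths from t (add an edge
   outside F, remove an edge of F, ...) reach two classes of vertices: a class S
   of vertices of F-degree b, and a class Y of vertices that can be made
   deficient instead of t.  As X is not full, every F-edge at S goes to Y, and
   every edge of G[X] at Y that is not in F goes to S; as X is maximum, Y has no
   neighbour outside X.  Hence |S| >= delta - 1, and F-degrees in Y are at
   most 2.  Let L be the path of F that starts at t and ends before the first
   vertex of degree at least 3; X \ L is full, and at most one F-edge joins L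
   to S.  So at least b|S| - 1 edges join S to Y \ L, which therefore contains
   an independent set of size at least floor(b (delta - 1) / 2), without
   neighbours in L or outside X.  It extends every independent set disjoint
   from X \ L.  If no near-full set is larger than W, the same search is run on
   W plus a vertex x having at most one neighbour outside W, where x must only
   receive degree 1, and L = {x}.

   In both cases some full set W' satisfies
   alpha(G - W') <= alpha(G) - floor(b (delta - 1) / 2), and G - W' is covered by
   cycles and at most alpha(G - W') edges and vertices. *)

Set Implicit Arguments.
Unset Strict Implicit.
Unset Printing Implicit Defensive.

(** * Alternating search *)

Section Edges.
Variable T : finType.
Implicit Types (F : rel T) (u v a : T).

Definition deg F v := #|[set y | F v y]|.

Definition edge u v : rel T :=
  fun a c => (a == u) && (c == v) || (a == v) && (c == u).

Definition add_edge F u v : rel T := fun a c => F a c || edge u v a c.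

Definition del_edge F u v : rel T := fun a c => F a c && ~~ edge u v a c.

Lemma edge_sym u v : symmetric (edge u v).
Proof. by move=> a c; rewrite /edge orbC andbC [X in _ || X]andbC. Qed.

Lemma add_edge_sym F u v : symmetric F -> symmetric (add_edge F u v).
Proof. by move=> sF a c; rewrite /add_edge sF edge_sym. Qed.

Lemma del_edge_sym F u v : symmetric F -> symmetric (del_edge F u v).
Proof. by move=> sF a c; rewrite /del_edge sF edge_sym. Qed.

Lemma eq_deg F F' v : F v =1 F' v -> deg F v = deg F' v.
Proof. by move=> FF'; rewrite /deg; apply: eq_card => y; rewrite !inE FF'. Qed.

Lemma deg_add_edge F u v a : symmetric F -> u != v -> ~~ F u v ->
  deg (add_edge F u v) a = deg F a + (a == u) + (a == v).
Proof.
move=> sF uv nF; rewrite /deg.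
have [->|au] := eqVneq a u.
  have -> : [set y | add_edge F u v u y] = v |: [set y | F u y].
    by apply/setP=> y; rewrite !inE /add_edge /edge eqxx (negbTE uv) /= orbF orbC.
  by rewrite cardsU1 inE nF (negbTE uv) /= addn0 addnC.
have [->|av] := eqVneq a v.
  have -> : [set y | add_edge F u v v y] = u |: [set y | F v y].
    by apply/setP=> y; rewrite !inE /add_edge /edge eqxx eq_sym (negbTE uv) /= orbC.
  by rewrite cardsU1 inE sF nF /= addn0 addnC.
rewrite !addn0; apply: eq_card => y.
by rewrite !inE /add_edge /edge (negbTE au) (negbTE av) orbF.
Qed.

Lemma deg_del_edge F u v a : symmetric F -> u != v -> F u v ->
  deg (del_edge F u v) a + (a == u) + (a == v) = deg F a.
Proof.
move=> sF uv Fuv; rewrite -deg_add_edge //; last 2 first.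
- exact: del_edge_sym.
- by rewrite /del_edge /edge !eqxx /= andbF.
apply: eq_deg => y; rewrite /add_edge /del_edge.
case E: (edge u v a y); last by rewrite orbF andbT.
rewrite orbT; case/orP: E => /andP[/eqP-> /eqP->] //; by rewrite sF.
Qed.

End Edges.

Section Search.
Variables (T : finType) (e : rel T) (b : nat) (g : T -> nat) (X : {set T}).
Hypotheses (e_sym : symmetric e) (e_irr : irreflexive e).
Hypotheses (b_gt2 : 2 < b) (g_le2 : forall v, g v <= 2).
Implicit Types (F : rel T) (p : seq T).

Definition subgraph_on F :=
  [/\ symmetric F, subrel F e & forall u v, F u v -> u \in X].

(** The lower bound [g] is 2 everywhere, except that in [full_efficient] one added vertex only has
    to reach degree 1. *)
Definition full F :=
  subgraph_on F /\ forall v, v \in X -> g v <= deg F v <= b.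

Definition near t F :=
  [/\ subgraph_on F, t \in X, (deg F t).+1 = g t &
      forall v, v \in X -> v != t -> g v <= deg F v <= b].

(* Steps leaving a saturated vertex remove an edge, the others add one. *)
Definition step F : rel T := fun u v =>
  if deg F u == b then F u v else [&& e u v, ~~ F u v & v \in X].

Lemma edge_neq u v : e u v -> u != v.
Proof. by apply: contraTneq => ->; rewrite e_irr. Qed.

Lemma subgraph_on_add F u v : subgraph_on F -> e u v -> u \in X -> v \in X ->
  subgraph_on (add_edge F u v).
Proof.
move=> [sF Fe FX] euv uX vX; split; first exact: add_edge_sym.
- move=> a c /orP[/Fe //|/orP[]/andP[/eqP-> /eqP->]] //; by rewrite e_sym.
- by move=> a c /orP[/FX //|/orP[]/andP[/eqP-> _]].
Qed.

Lemma subgraph_on_del F u v : subgraph_on F -> subgraph_on (del_edge F u v).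
Proof.
move=> [sF Fe FX]; split; first exact: del_edge_sym.
- by move=> a c /andP[/Fe].
- by move=> a c /andP[/FX].
Qed.

Lemma near_add F t s : near t F -> e t s -> ~~ F t s -> s \in X ->
  deg F s < b -> full (add_edge F t s).
Proof.
move=> [sub tX dt dF] ets nF sX ds; split; first exact: subgraph_on_add.
case: sub => sF _ _ v vX; have ts := edge_neq ets.
rewrite deg_add_edge //.
have [->|vt] := eqVneq v t.
  by rewrite (negbTE ts) addn0 addn1 dt leqnn (leq_trans (g_le2 t)) // ltnW.
by move: ds (dF _ vX vt); have [->|_] := eqVneq v s; clear; lia.
Qed.

(** Two steps of an alternating path at once: the deficiency moves from [t] to [z], while [s] keeps
    its degree. *)
Definition shift F t s z := del_edge (add_edge F t s) s z.

Lemma deg_shift F t s z v : near t F -> e t s -> ~~ F t s -> F s z ->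
  deg (shift F t s z) v + (v == z) = deg F v + (v == t).
Proof.
move=> [[sF Fe _] _ _ _] ets nF Fsz.
have ts := edge_neq ets.
have sz : s != z by apply/edge_neq/Fe.
have : add_edge F t s s z by rewrite /add_edge Fsz.
move/(deg_del_edge v (add_edge_sym _ _ sF) sz); rewrite deg_add_edge //.
by rewrite -/(shift F t s z) addnAC => /addIn.
Qed.

Lemma shift_sub F t s z : near t F -> e t s -> s \in X ->
  subgraph_on (shift F t s z).
Proof.
by move=> [sub tX _ _] ets sX; apply/subgraph_on_del/subgraph_on_add.
Qed.

Lemma near_shift_full F t s z : near t F -> e t s -> ~~ F t s -> s \in X ->
  F s z -> g z < deg F z -> full (shift F t s z).
Proof.
move=> nr ets nF sX Fsz dz; split; first exact: shift_sub.
move=> v vX; have := deg_shift v nr ets nF Fsz.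
case: nr => [[sF Fe FX] tX dt dF].
have zt : (z == t) = false by apply: contraNF nF => /eqP<-; rewrite sF.
have zX : z \in X by rewrite sF in Fsz; exact: FX Fsz.
have [->|vt] := eqVneq v t.
  rewrite eq_sym zt addn0 addn1 dt => ->.
  by rewrite leqnn (leq_trans (g_le2 t)) // ltnW.
have := dF _ vX vt.
by move: dz; have [->|_] := eqVneq v z; clear; lia.
Qed.

Lemma near_shift F t s z : near t F -> e t s -> ~~ F t s -> s \in X ->
  F s z -> deg F z = g z -> near z (shift F t s z).
Proof.
move=> nr ets nF sX Fsz dz.
have E := fun v => deg_shift v nr ets nF Fsz.
have sub := shift_sub z nr ets sX.
case: nr => [[sF Fe FX] tX dt dF].
have zt : (z == t) = false by apply: contraNF nF => /eqP<-; rewrite sF.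
have zX : z \in X by rewrite sF in Fsz; exact: FX Fsz.
split=> //; first by rewrite -addn1; have := E z; rewrite eqxx zt addn0 dz.
move=> v vX vz; have := E v; rewrite (negbTE vz) addn0 => ->.
have [->|vt] := eqVneq v t; last by rewrite addn0 dF.
by rewrite addn1 dt leqnn (leq_trans (g_le2 t)) // ltnW.
Qed.

Hypothesis no_full : forall F, ~ full F.

Lemma near_unsaturated t F : near t F -> (deg F t == b) = false.
Proof.
by case=> _ _ dt _; apply/eqP; move: dt (g_le2 t) b_gt2; clear; lia.
Qed.

(** If the first vertex after [t] were unsaturated, adding one edge would give a full subgraph; if
    the second were above its lower bound, a shift would. Otherwise the shift makes the second
    vertex deficient and the rest of the path is handled by induction. As the path loses two
    vertices at a time, the induction is on a bound for its length. *)
Lemma near_alternates n p F t : size p <= n -> near t F ->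
  path (step F) t p -> uniq (t :: p) ->
  if odd (size p) then deg F (last t p) = b
  else deg F (last t p) <= g (last t p) /\ exists F', near (last t p) F'.
Proof.
elim: n p F t => [|n IHn] [|s [|z p]] F t //=; try by move=> _ nr _ _;
  split; [case: nr => _ _ <- _; exact: leqnSn | exists F].
- move=> _ nr /andP[st _] _.
  have dt : deg F t == b = false by exact: near_unsaturated.
  move: st; rewrite /step dt => /and3P[ets nF sX].
  have [//|ds] := eqVneq (deg F s) b.
  case: (@no_full (add_edge F t s)); apply: near_add => //.
  case: (nr) => _ _ _ /(_ s sX); rewrite eq_sym (edge_neq ets) => /(_ isT).
  by rewrite ltn_neqAle ds => /andP[].
- move=> szp nr /and3P[st sz pa] /and3P[tn sn un].
  have dt : deg F t == b = false by exact: near_unsaturated.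
  move: st; rewrite /step dt => /and3P[ets nF sX].
  have stn : s != t by rewrite eq_sym edge_neq.
  have ds : deg F s = b.
    have [//|ds] := eqVneq (deg F s) b.
    case: (@no_full (add_edge F t s)); apply: near_add => //.
    case: (nr) => _ _ _ /(_ s sX stn) /andP[_].
    by rewrite ltn_neqAle ds.
  move: sz; rewrite /step ds eqxx => Fsz.
  have zX : z \in X by case: (nr) => [[sF _ FX] _ _ _]; rewrite sF in Fsz; exact: FX Fsz.
  have zt : z != t by apply: contraNneq nF => <-; case: (nr) => [[-> _ _] _ _ _].
  have dz : deg F z = g z.
    case: (nr) => _ _ _ /(_ z zX zt) => /andP[g1 _].
    have [//|dz] := eqVneq (deg F z) (g z).
    case: (@no_full (shift F t s z)); apply: near_shift_full => //.
    by rewrite ltn_neqAle eq_sym dz.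
  have nr1 := near_shift nr ets nF sX Fsz dz.
  have E := fun v => deg_shift v nr ets nF Fsz.
  have Eo v : v \in p -> deg (shift F t s z) v = deg F v.
    move=> vp; have := E v.
    have /negbTE-> : v != t by apply: contraNneq tn => <-; rewrite !inE vp !orbT.
    have /negbTE-> : v != z by apply: contraTneq un => <-; rewrite /= vp.
    by rewrite !addn0.
  (* The shift only alters edges at [s], which [z :: p] avoids, and the degrees of [t] and [z].
     Since [z] is unsaturated before and after, the steps along [z :: p] are unchanged. *)
  have pa1 : path (step (shift F t s z)) z p.
    move: pa; rewrite (@eq_in_path _ (mem (z :: p)) (step (shift F t s z)) (step F)) //; last by apply/allP.
    move=> u v uzp vzp.
    have us : (u == s) = false by apply: contraNF sn => /eqP<-.
    have vs : (v == s) = false by apply: contraNF sn => /eqP<-.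
    have Fuv : shift F t s z u v = F u v.
      by rewrite /shift /del_edge /add_edge /edge us vs !andbF /= !orbF andbT.
    rewrite /step Fuv; suff -> : (deg (shift F t s z) u == b) = (deg F u == b) by [].
    move: uzp; rewrite inE => /orP[/eqP->|up]; last by rewrite Eo.
    rewrite (near_unsaturated nr1) dz; symmetry; apply/eqP.
    by move: (g_le2 z) b_gt2; clear; lia.
  have := IHn p _ z _ nr1 pa1 un.
  rewrite negbK => /(_ (ltnW szp)).
  case: p {szp pa tn sn pa1} un Eo => [|y p] un Eo /=.
    by rewrite dz => -[_ ?]; split.
  by rewrite Eo // mem_last.
Qed.

End Search.

(** * Independent sets from an exhausted search *)

Lemma independentP (T : finType) (e : rel T) (A : {set T}) :
  reflect {in A &, forall x y, ~~ e x y} (independent e A).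
Proof.
apply: (iffP forall_inP) => [H x y xA yA | H x xA].
  by have /forall_inP/(_ y yA) := H x xA.
by apply/forall_inP => y yA; apply: H.
Qed.

Lemma card_sum (T : finType) (A : {set T}) (P : pred T) :
  #|[set y in A | P y]| = \sum_(y in A) P y.
Proof.
rewrite -sum1_card big_mkcond [RHS]big_mkcond; apply: eq_bigr => y _.
by rewrite inE; case: (y \in A); case: (P y).
Qed.

(* Y induces a graph of maximum degree at most 1, and the vertices of a
   component of it send at most 2 edges of F to S. *)
Lemma large_independent (T : finType) (e F : rel T) (S Y : {set T}) :
  symmetric e -> irreflexive e -> symmetric F -> [disjoint S & Y] ->
  {in Y, forall v, deg F v <= 2} -> {in Y, forall v, exists2 s, s \in S & F s v} ->
  {in Y &, forall u v, e u v -> F u v} ->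
  exists I : {set T}, [/\ I \subset Y, independent e I &
    \sum_(s in S) #|[set y in Y | F s y]| <= 2 * #|I|].
Proof.
move=> e_sym e_irr sF dSY degY hS eF.
pose P (I : {set T}) := (I \subset Y) && independent e I.
have P0 : P set0.
  by rewrite /P sub0set; apply/independentP => x y; rewrite inE.
have [I /maxsetP[/andP[IY iI] Imax] _] := maxset_exists P0.
exists I; split => //.
pose a v := #|[set s in S | F v s]|.
pose c v := #|[set y in Y | F v y]|.
have ac v : v \in Y -> a v + c v <= 2.
  move=> vY; apply: leq_trans (degY v vY); rewrite /a /c /deg -cardsUI.
  have -> : [set s in S | F v s] :&: [set y in Y | F v y] = set0.
    apply/setP=> y; rewrite !inE; apply/negP => /andP[/andP[yS _] /andP[yY _]].
    by have := disjointFr dSY yS; rewrite yY.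
  rewrite cards0 addn0; apply: subset_leq_card; apply/subsetP => y.
  by rewrite !inE => /orP[]/andP[].
have nb u : u \in Y -> u \notin I -> exists2 v, v \in I & F v u.
  move=> uY uI; apply: NNPP => no.
  suff uIP : P (u |: I).
    by move: uI; rewrite -(Imax _ uIP (subsetUr _ _)) !inE eqxx.
  rewrite /P subUset sub1set uY IY; apply/independentP.
  have nu v : v \in I -> ~~ e u v.
    move=> vI; apply/negP => euv; apply: no; exists v => //.
    by rewrite sF; apply: eF => //; apply: (subsetP IY).
  move=> x y; rewrite !inE => /orP[/eqP->|xI] /orP[/eqP->|yI].
  - by rewrite e_irr.
  - exact: nu.
  - by rewrite e_sym nu.
  - by move/independentP: iI; apply.
have -> : \sum_(s in S) #|[set y in Y | F s y]| = \sum_(v in Y) a v.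
  under eq_bigr do rewrite card_sum.
  rewrite exchange_big; apply: eq_bigr => v _; rewrite /a card_sum.
  by apply: eq_bigr => s _; rewrite sF.
rewrite (big_setID I) (setIidPr IY) /= mulnC -sum_nat_const.
(* A vertex [v] of [I] has at most [2 - a v] edges of [F] into [Y]. By maximality each vertex of [Y]
   outside [I] receives one of these edges, which leaves it at most one edge to [S]. *)
have -> : \sum_(v in I) 2 = \sum_(v in I) a v + \sum_(v in I) (2 - a v).
  rewrite -big_split /=; apply: eq_bigr => v /(subsetP IY)/ac.
  by clear; lia.
rewrite leq_add2l; apply: leq_trans (_ : \sum_(v in I) c v <= _); last first.
  by apply: leq_sum => v /(subsetP IY)/ac; clear; lia.
rewrite /c; under [leqRHS]eq_bigr do rewrite card_sum.
rewrite exchange_big /= [leqRHS](big_setID I) /= (setIidPr IY).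
apply: leq_trans (leq_addl _ _); apply: leq_sum => u.
rewrite inE => /andP[uI uY]; have [v vI Fvu] := nb u uY uI.
apply: leq_trans (_ : 1 <= _); last by rewrite (bigD1 v) //= Fvu.
suff : 0 < c u by move: (ac u uY); clear; lia.
by apply/card_gt0P; exists v; rewrite inE sF Fvu (subsetP IY).
Qed.

Section Closure.
Variables (T : finType) (e : rel T) (b : nat) (g : T -> nat) (X : {set T}).
Hypotheses (e_sym : symmetric e) (e_irr : irreflexive e).
Hypotheses (b_gt2 : 2 < b) (g_le2 : forall v, g v <= 2).
Variables (t : T) (F : rel T).
Hypotheses (no_full : forall F, ~ full e b g X F) (near_t : near e b g X t F).

(** Reachability allows repeated vertices while [near_alternates] does not; [reach_uniq] bridges the
    two. The vertices of [Y] are those that can take over the deficiency, by [reach_near]. *)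
Let A := [set v | connect (step e b X F) t v].
Let S := [set v in A | deg F v == b].
Let Y := [set v in A | deg F v != b].

Lemma reach_uniq v : v \in A ->
  exists p, [/\ path (step e b X F) t p, uniq (t :: p) & last t p = v].
Proof.
by rewrite inE => /connectP[p tp ->]; case/shortenP: tp => q ? ? _; exists q.
Qed.

Lemma reach_parity p : path (step e b X F) t p -> uniq (t :: p) ->
  (deg F (last t p) == b) = odd (size p).
Proof.
move=> pa un; have := near_alternates e_sym e_irr b_gt2 g_le2 no_full (leqnn _) near_t pa un.
case: odd => [->|[dl _]]; first by rewrite eqxx.
by apply/eqP; move: dl (g_le2 (last t p)) b_gt2; clear; lia.
Qed.

Lemma reach_sub : A \subset X.
Proof.
case: near_t => [[sF _ FX] tX _ _].
apply/subsetP => v /reach_uniq[p [pa _ <-]]; elim/last_ind: p pa => //= p w _.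
rewrite rcons_path last_rcons => /andP[_]; rewrite /step; case: ifP => _.
  by rewrite sF => /FX.
by case/and3P.
Qed.

Lemma reach_near v : v \in Y -> deg F v <= g v /\ exists F', near e b g X v F'.
Proof.
rewrite inE => /andP[/reach_uniq[p [pa un <-]]]; rewrite (reach_parity pa un).
have := near_alternates e_sym e_irr b_gt2 g_le2 no_full (leqnn _) near_t pa un.
by case: odd.
Qed.

Lemma step_neq u v : step e b X F u v -> u != v.
Proof.
case: near_t => [[_ Fe _] _ _ _].
by rewrite /step; case: ifP => _; [move/Fe|case/and3P]; move/(edge_neq e_irr).
Qed.

(** If [w] is not on a simple path to [v], appending it changes the parity of the length. If [w] is
    on the path and has the same saturation as [v], the step can be reversed, so the initial part up
    to [w] followed by [v] is a simple path that contradicts [reach_parity]. *)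
Lemma reach_alternates v w : v \in A -> step e b X F v w ->
  (deg F w == b) = (deg F v != b).
Proof.
move=> vA vw; have vX := subsetP reach_sub v vA.
have [p [pa un lp]] := reach_uniq vA.
have [wp|wp] := boolP (w \in t :: p); last first.
  have pa' : path (step e b X F) t (rcons p w) by rewrite rcons_path pa lp.
  have un' : uniq (t :: rcons p w) by rewrite -rcons_cons rcons_uniq wp.
  have := reach_parity pa' un'; rewrite last_rcons size_rcons /= => ->.
  by rewrite -(reach_parity pa un) lp.
have [E|] := eqVneq (deg F w == b) (deg F v == b); last by do 2!case: (_ == b).
case/splitPl: p / wp pa un lp => p1 p2 lp1.
rewrite cat_path -cat_cons cat_uniq last_cat => /andP[pa1 pa2] /and3P[un1 /hasPn dis _] lp.
have vp2 : v \in p2.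
  case: p2 lp {pa2 dis} => [|y p2] /= lp; last by rewrite -lp mem_last.
  by have := step_neq vw; rewrite -lp lp1 eqxx.
have wv : step e b X F w v.
  case: near_t => [[sF _ _] _ _ _].
  move: vw; rewrite /step E; case: ifP => _; first by rewrite sF.
  by rewrite e_sym sF vX andbT => /and3P[-> ->].
have pa' : path (step e b X F) t (rcons p1 v) by rewrite rcons_path pa1 lp1.
have un' : uniq (t :: rcons p1 v) by rewrite -rcons_cons rcons_uniq un1 andbT dis.
have := reach_parity pa' un'; rewrite last_rcons size_rcons /=.
by rewrite -(reach_parity pa1 un1) lp1 E; case: eqP.
Qed.

Lemma reach_step v w : v \in A -> step e b X F v w -> w \in A.
Proof. by rewrite !inE => tv vw; apply: connect_trans tv (connect1 vw). Qed.

Lemma saturated_nbr s z : s \in S -> F s z -> z \in Y.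
Proof.
rewrite inE => /andP[sA ds] Fsz.
have sz : step e b X F s z by rewrite /step ds.
by rewrite inE (reach_step sA sz) (reach_alternates sA sz) ds.
Qed.

Lemma unsaturated_nbr v s : v \in Y -> e v s -> ~~ F v s -> s \in X -> s \in S.
Proof.
rewrite inE => /andP[vA dv] evs nF sX.
have vs : step e b X F v s by rewrite /step (negbTE dv) evs nF.
by rewrite inE (reach_step vA vs) (reach_alternates vA vs).
Qed.

Lemma unsaturated_pred v : v \in Y -> v != t -> exists2 s, s \in S & F s v.
Proof.
rewrite inE => /andP[vA dv] vt; have [p [pa un lp]] := reach_uniq vA.
case/lastP: p pa un lp => [_ _ /eqP|p w]; first by rewrite eq_sym (negbTE vt).
rewrite rcons_path last_rcons => /andP[pa uw] _ wv; rewrite {w}wv in uw.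
have uA : last t p \in A by rewrite inE; apply/connectP; exists p.
have := reach_alternates uA uw; rewrite (negbTE dv) => /esym/negbFE du.
by exists (last t p); [rewrite inE uA | move: uw; rewrite /step du].
Qed.

(** [K] is [J] together with the independent set that [large_independent] finds in [Y :\: L]. The
    set [L] will be a hanging path or a single vertex, left by at most one edge [v0 u0] of [F]; the
    successor on the right pays for that edge. The condition on vertices without neighbours outside
    [X] offers both a degree bound and a near-full subgraph, as the two applications rely on
    different ones. *)
Lemma search_independent (L J : {set T}) (v0 u0 : T) :
  t \in L -> {in L, forall v, deg F v <= 2} ->
  (forall v u, v \in L -> u \notin L -> F v u -> [/\ v = v0, u = u0 & 2 < deg F u]) ->
  (forall v w, v \in X -> v \notin L -> deg F v <= 2 ->
     (exists F', near e b g X v F') -> w \notin X -> ~~ e v w) ->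
  #|[set w | e t w & w \notin X]| + deg F t <= 1 ->
  independent e J -> {in J, forall j, j \in X -> j \in L} ->
  exists2 K, independent e K & 2 * #|J| + b * (deg e t - 1) <= (2 * #|K|).+1.
Proof.
move=> tL dL Lout noX dt iJ JL; case: (near_t) => [[sF Fe FX] tX _ _].
have tY : t \in Y.
  by rewrite inE (near_unsaturated b_gt2 g_le2 near_t) inE connect0.
have SX : {subset S <= X} by move=> s; rewrite inE => /andP[/(subsetP reach_sub)].
have SY s : s \in S -> s \notin Y.
  by rewrite !inE => /andP[_ ->]; rewrite andbF.
have dY v : v \in Y -> deg F v <= 2.
  by move=> vY; have [dv _] := reach_near vY; apply: leq_trans dv (g_le2 v).
have YX v : v \in Y -> v \in X by rewrite inE => /andP[/(subsetP reach_sub)].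
have dS s : s \in S -> deg F s = b by rewrite inE => /andP[_ /eqP].
have SL s : s \in S -> s \notin L.
  by move/dS => ds; apply/negP => /dL; rewrite ds leqNgt b_gt2.
have [] := @large_independent T e F S (Y :\: L) e_sym e_irr sF.
- by rewrite disjoint_subset; apply/subsetP => s /SY; rewrite !inE => /negbTE->; rewrite andbF.
- by move=> v; rewrite inE => /andP[_ /dY].
- move=> v; rewrite inE => /andP[vL vY]; apply: unsaturated_pred => //.
  by apply: contraNneq vL => ->.
- move=> u v; rewrite !in_setD => /andP[_ uY] /andP[_ vY] euv.
  apply: contraT => nF; have := unsaturated_nbr uY euv nF (YX _ vY).
  by move/SY; rewrite vY.
move=> I [/subsetP IY iI cI].
(* If [j] is in [L], an edge of [F] from [v] to [j] would force [v] to have degree above 2, and an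
   edge outside [F] would make [j] saturated; neither is possible. *)
have IJ v j : v \in I -> j \in J -> ~~ e v j.
  move=> /IY; rewrite in_setD => /andP[vL vY] jJ.
  have [jX|jX] := boolP (j \in X); last first.
    by apply: noX => //; [exact: YX | exact: dY | case: (reach_near vY)].
  have jL := JL j jJ jX; apply/negP => evj.
  have [Fvj|nF] := boolP (F v j).
    have [_ _] : [/\ j = v0, v = u0 & 2 < deg F v] by apply: Lout; rewrite // sF.
    by rewrite ltnNge dY.
  by have := SL j (unsaturated_nbr vY evj nF jX); rewrite jL.
exists (I :|: J).
  apply/independentP => x y; rewrite !inE => /orP[xI|xJ] /orP[yI|yJ].
  - by move/independentP: iI; apply.
  - exact: IJ.
  - by rewrite e_sym IJ.
  - by move/independentP: iJ; apply.
have cU : #|I :|: J| = #|I| + #|J|.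
  rewrite -cardsUI; have -> : I :&: J = set0; last by rewrite cards0 addn0.
  apply/setP => j; rewrite !inE; apply/negP => /andP[/IY].
  by rewrite in_setD => /andP[jL /YX jX] /JL/(_ jX); rewrite (negbTE jL).
(* A neighbour of [t] is outside [X], joined to [t] by [F], or in [S]; by [dt] at most one is of the
   first two kinds. *)
have cS : deg e t - 1 <= #|S|.
  set O := [set w | e t w & w \notin X] in dt.
  have sub : [set w | e t w] \subset O :|: [set w | F t w] :|: S.
    apply/subsetP => w; rewrite in_set => etw; rewrite !in_setU.
    have [wX|wX] := boolP (w \in X); last by rewrite [w \in O]in_set etw wX.
    have [Ftw|nF] := boolP (F t w).
      by rewrite (_ : w \in [set w | F t w]) ?orbT // in_set.
    by rewrite (unsaturated_nbr tY etw nF wX) orbT.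
  rewrite leq_subLR; apply: leq_trans (leq_add dt (leqnn _)).
  apply: leq_trans (subset_leq_card sub) _.
  apply: leq_trans (leq_card_setU _ _) _; rewrite leq_add2r.
  exact: leq_card_setU.
(* All [b] edges of [F] at a vertex of [S] go to [Y], and at most one of all these edges, [v0 u0],
   ends in [L]. *)
have sumS : b * #|S| <= (2 * #|I|).+1.
  rewrite mulnC -sum_nat_const.
  apply: leq_trans (_ : \sum_(s in S) (#|[set y in Y :\: L | F s y]| + (s == u0)) <= _).
    apply: leq_sum => s sS; rewrite -{1}(dS s sS) /deg.
    rewrite -(cardsID L) addnC; apply: leq_add.
      apply: subset_leq_card; apply/subsetP => y; rewrite !in_setD !in_set.
      by move=> /andP[yL Fsy]; rewrite yL Fsy andbT; have := saturated_nbr sS Fsy; rewrite !inE.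
    have [su|su] := eqVneq s u0.
      apply: leq_trans (_ : #|[set v0]| <= _); last by rewrite cards1.
      apply: subset_leq_card; apply/subsetP => y.
      rewrite !inE sF => /andP[Fys yL].
      by have [-> _ _] := Lout y s yL (SL s sS) Fys.
    rewrite leqn0 cards_eq0; apply/eqP/setP => y; rewrite !inE sF.
    apply/negP => /andP[Fys yL]; have [_ E _] := Lout y s yL (SL s sS) Fys.
    by rewrite E eqxx in su.
  rewrite big_split /= -[X in _ <= X]addn1; apply: leq_add => //.
  rewrite -card_sum -(cards1 u0); apply: subset_leq_card; apply/subsetP => s.
  by rewrite !inE => /andP[].
rewrite cU mulnDr [2 * #|I| + _]addnC -addnS leq_add2l.
by apply: leq_trans sumS; rewrite leq_mul2l cS orbT.
Qed.

End Closure.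

(** * Cycles and coverings *)

(** The predicates maximized below quantify over relations and are not boolean, hence the classical
    argument. *)
Lemma ex_max_nat (P : nat -> Prop) m : (exists n, P n) ->
  (forall n, P n -> n <= m) -> exists2 n, P n & forall k, P k -> k <= n.
Proof.
move=> [n Pn] Pm; have [k] := ubnP (m - n).
elim: k n Pn => // k IHk n Pn mn.
have [[l [Pl nl]]|no] := classic (exists l, P l /\ n < l).
  by apply: (IHk l) => //; move: (Pm l Pl) nl mn; clear; lia.
exists n => // l Pl; rewrite leqNgt; apply/negP => nl; apply: no; by exists l.
Qed.

Section Cover.
Variables (T : finType) (e : rel T) (b : nat).
Hypotheses (e_sym : symmetric e) (e_irr : irreflexive e) (b_gt2 : 2 < b).
Implicit Types (X R I C : {set T}) (F f : rel T).

Local Notation full2 := (full e b (fun=> 2)).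
Local Notation near2 := (near e b (fun=> 2)).

Lemma deg_out X F v : subgraph_on e X F -> v \notin X -> deg F v = 0.
Proof.
move=> [_ _ FX] vX; apply/eqP; rewrite cards_eq0; apply/eqP/setP => y.
by rewrite !inE; apply: contraNF vX => /FX.
Qed.

Lemma deg_relU X F F' v : subgraph_on e X F' -> v \notin X ->
  deg (relU F F') v = deg F v.
Proof.
move=> [_ _ FX] vX; apply: eq_deg => y /=.
by rewrite (_ : F' v y = false) ?orbF //; apply: contraNF vX => /FX.
Qed.

Lemma deg_relUr X F F' v : subgraph_on e X F -> v \notin X ->
  deg (relU F F') v = deg F' v.
Proof.
move=> sub vX; rewrite -(deg_relU F' sub vX).
by apply: eq_deg => y /=; rewrite orbC.
Qed.

Lemma subgraph_on_union X X' F F' : subgraph_on e X F -> subgraph_on e X' F' ->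
  subgraph_on e (X :|: X') (relU F F').
Proof.
move=> [sF Fe FX] [sF' Fe' FX']; split.
- by move=> u v /=; rewrite sF sF'.
- by move=> u v /orP[/Fe|/Fe'].
- by move=> u v /orP[/FX uX|/FX' uX]; rewrite inE uX ?orbT.
Qed.

Lemma full_union X X' F F' : [disjoint X & X'] -> full2 X F -> full2 X' F' ->
  full2 (X :|: X') (relU F F').
Proof.
move=> dX [sub dF] [sub' dF']; split; first exact: subgraph_on_union.
move=> v; rewrite inE; have [vX _|vX /= vX'] := boolP (v \in X).
  by rewrite (deg_relU _ sub') ?dF // (disjointFr dX vX).
by rewrite (deg_relUr _ sub) ?dF'.
Qed.

Lemma next_neq_prev (c : seq T) u : uniq c -> 2 < size c -> u \in c ->
  next c u != prev c u.
Proof.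
move=> un sz uc; apply/eqP => E.
have := next_prev un u; rewrite -E => N.
case: (rot_to uc) => i c' Ec.
have un' : uniq (u :: c') by rewrite -Ec rot_uniq.
have sz' : 2 < size (u :: c') by rewrite -Ec size_rot.
have N' : next (u :: c') (next (u :: c') u) = u by rewrite -Ec !next_rot.
case: c' un' sz' N' {Ec} => [|a [|d s]] //= un' _.
rewrite eqxx; case/and3P: un'; rewrite !inE !negb_or => /and3P[ua ud _] _ _.
by rewrite eq_sym (negbTE ua) eqxx => du; rewrite du eqxx in ud.
Qed.

Lemma cycle_full (c : seq T) : cycle e c -> uniq c -> 2 < size c ->
  exists F, full2 [set u in c] F.
Proof.
move=> cy un sz.
exists (fun u v => (u \in c) && ((v == next c u) || (v == prev c u))).
split; first split.
- move=> u v; apply/idP/idP => /andP[uc /orP[]/eqP->].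
  + by rewrite mem_next uc prev_next // eqxx orbT.
  + by rewrite mem_prev uc next_prev // eqxx.
  + by rewrite mem_next uc prev_next // eqxx orbT.
  + by rewrite mem_prev uc next_prev // eqxx.
- move=> u v /andP[uc /orP[]/eqP->]; first exact: next_cycle.
  by rewrite e_sym; apply: prev_cycle.
- by move=> u v /andP[uc _]; rewrite inE.
move=> v; rewrite inE => vc.
have -> : deg (fun u v => (u \in c) && ((v == next c u) || (v == prev c u))) v
    = #|[set next c v; prev c v]|.
  by apply: eq_card => y; rewrite !inE vc.
by rewrite cards2 (next_neq_prev un sz vc) (ltnW b_gt2).
Qed.

(** All neighbours in [R] of the first vertex of a longest path lie on that path; one of them other
    than the second vertex closes a cycle. *)
Lemma min_degree2_full R : R != set0 ->
  {in R, forall v, 2 <= #|[set w in R | e v w]|} ->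
  exists C F, [/\ C \subset R, C != set0 & full2 C F].
Proof.
move=> /set0Pn[x0 x0R] dR.
pose P n := exists x p, [/\ path e x p, uniq (x :: p), {subset x :: p <= R} & size p = n].
have [||n [x [p [pa un pR szp]]] nmax] := @ex_max_nat P #|T|.
- by exists 0, x0, [::]; split => // y; rewrite inE => /eqP->.
- move=> n [x [p [_ un _ <-]]]; apply: ltnW.
  by rewrite -[(size p).+1]/(size (x :: p)) -(card_uniqP un) max_card.
have xR : x \in R by apply: pR; rewrite inE eqxx.
have nbp y : y \in R -> e x y -> y \in p.
  move=> yR exy; apply: contraT => yp.
  suff : n.+1 <= n by rewrite ltnn.
  apply: nmax; exists y, (x :: p); split => /=.
  - by rewrite e_sym exy.
  - by move: un => /= ->; rewrite inE negb_or yp andbT eq_sym (edge_neq e_irr exy).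
  - by move=> z; rewrite inE => /orP[/eqP->|/pR].
  - by rewrite szp.
case: p pa un pR szp nbp => [|z q] pa un pR szp nbp.
  have /card_gt0P[y] : 0 < #|[set w in R | e x w]| by apply: ltnW; apply: dR.
  by rewrite inE => /andP[yR exy]; have := nbp y yR exy.
have [y yR [exy yz]] : exists2 y, y \in R & e x y /\ y != z.
  have : 0 < #|[set w in R | e x w] :\ z|.
    by have := dR x xR; rewrite (cardsD1 z); case: (z \in _); clear; lia.
  by case/card_gt0P=> y; rewrite !inE => /and3P[yz yR exy]; exists y.
have := nbp y yR exy; rewrite inE (negbTE yz) /= => yq.
case/splitPr: q / yq pa un pR szp nbp => q1 q2 pa un pR _ _.
pose c := x :: z :: rcons q1 y.
have sub : {subset c <= R}.
  move=> w wc; apply: pR; move: wc.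
  by rewrite /c -cat_rcons !inE mem_cat => /or3P[->|->|->]; rewrite ?orbT.
have [] := @cycle_full c.
- move: pa; rewrite /c /= -cat_rcons cat_path => /and3P[-> pa _].
  by rewrite rcons_path pa last_rcons e_sym exy.
- by move: un; rewrite /c -cat_rcons -!cat_cons cat_uniq => /and3P[].
- by rewrite /c /= size_rcons.
move=> F fF; exists [set u in c], F; split => //.
  by apply/subsetP => w; rewrite inE => /sub.
by apply/set0Pn; exists x; rewrite !inE eqxx.
Qed.

(* The component of v is {p, q}; it is a single vertex when p = q. *)
Definition in_trivial f I v := exists p q,
  [/\ p \in I, (v == p) || (v == q), (p == q) || f p q &
      forall w, (f p w -> w = q) /\ (f q w -> w = p)].

(** [I] contains an end of every component on one or two vertices, so its size bounds their
    number. *)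
Definition covering R f I := subgraph_on e R f /\
  forall v, v \in R -> (2 <= deg f v <= b) \/ in_trivial f I v.

Lemma in_trivial_union R R' f f' I I' v : [disjoint R & R'] ->
  subgraph_on e R f -> subgraph_on e R' f' -> v \in R -> in_trivial f I v ->
  in_trivial (relU f f') (I :|: I') v.
Proof.
move=> dR [sf fe fR] [sf' _ fR'] vR [p [q [pI vpq pq cl]]]; exists p, q.
have [pR qR] : p \in R /\ q \in R.
  case/orP: pq => [/eqP E|fpq]; last by split; [exact: fR fpq | rewrite sf in fpq; exact: fR fpq].
  by move: vpq vR; rewrite -E orbb => /eqP->.
have n' r w : r \in R -> f' r w = false.
  by move=> rR; apply: contraTF rR => /fR'; apply: contraL => /(disjointFr dR)->.
split => //; first by rewrite inE pI.
- by case/orP: pq => /= ->; rewrite ?orbT.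
- by move=> w /=; rewrite !n' ?orbF.
Qed.

Lemma cover_union R R' f f' I I' : [disjoint R & R'] -> covering R f I ->
  covering R' f' I' -> covering (R :|: R') (relU f f') (I :|: I').
Proof.
move=> dR [sub cf] [sub' cf']; split; first exact: subgraph_on_union.
move=> v; rewrite inE; have [vR _|vR /= vR'] := boolP (v \in R).
  rewrite (deg_relU _ sub') ?(disjointFr dR vR) //.
  case: (cf v vR) => [|tv]; first by left.
  by right; apply: (in_trivial_union I' dR sub sub').
rewrite (deg_relUr _ sub) //; case: (cf' v vR'); first by left.
move=> tv; right; rewrite disjoint_sym in dR.
have [p [q [pI vpq pq cl]]] := in_trivial_union I dR sub' sub vR' tv.
exists p, q; split => //=; first by rewrite setUC.
- by move: pq => /=; rewrite [f' p q || _]orbC.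
- by move=> w; have := cl w; rewrite /= ![f' _ w || _]orbC.
Qed.

Lemma full_cover X F : full2 X F -> covering X F set0.
Proof. by case=> sub dF; split=> // v vX; left; apply: dF. Qed.

Lemma cover_vertex x : covering [set x] (fun _ _ => false) [set x].
Proof.
split=> // v; rewrite inE => /eqP->; right; exists x, x.
by split=> //; rewrite ?inE ?eqxx.
Qed.

Lemma cover_edge x y : e x y -> covering [set x; y] (edge x y) [set x].
Proof.
move=> exy; have xy := edge_neq e_irr exy.
split; first split.
- exact: edge_sym.
- by move=> u v /orP[]/andP[/eqP-> /eqP->] //; rewrite e_sym.
- by move=> u v /orP[]/andP[/eqP-> _]; rewrite !inE eqxx ?orbT.
move=> v; rewrite !inE => vxy; right; exists x, y; split=> //.
- by rewrite inE.
- by rewrite /edge !eqxx orbT.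
move=> w; rewrite /edge !eqxx [y == x]eq_sym (negbTE xy) /= orbF.
by split=> /eqP.
Qed.

(** Induction on the size of [R]. If all degrees inside [R] are at least 2, a cycle is split off and
    [I] does not grow. Otherwise some [x] has at most one neighbour in [R]; splitting off [x] with
    that neighbour puts [x] into [I], and nothing adjacent to [x] remains. *)
Lemma cover_exists R :
  exists f I, [/\ covering R f I, I \subset R & independent e I].
Proof.
have [n] := ubnP #|R|; elim: n R => // n IHn R szR.
have [->|R0] := eqVneq R set0.
  exists (fun _ _ => false), set0; split; rewrite ?sub0set //.
    by split=> // v; rewrite inE.
  by apply/independentP => u v; rewrite inE.
have IH C : C \subset R -> C != set0 -> exists f I,
    [/\ covering (R :\: C) f I, I \subset R :\: C & independent e I].
  move=> CR C0; apply: IHn; rewrite cardsD (setIidPr CR).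
  by move: szR C0 (subset_leq_card CR); rewrite -card_gt0; clear; lia.
have dC C : [disjoint C & R :\: C].
  by rewrite disjoint_sym disjoint_subset; apply/subsetP => v; rewrite !inE => /andP[].
have unC C : C \subset R -> C :|: (R :\: C) = R.
  by move=> CR; rewrite -{1}(setIidPr CR) setID.
have [dR|] := classic ({in R, forall v, 2 <= #|[set w in R | e v w]|}).
  have [C [F [CR C0 fF]]] := min_degree2_full R0 dR.
  have [f [I [cf IR iI]]] := IH C CR C0.
  exists (relU F f), (set0 :|: I); rewrite -{1}(unC C CR); split.
  - by apply: cover_union (dC C) _ cf; apply: full_cover.
  - by rewrite set0U; apply: subset_trans IR (subsetDl _ _).
  - by rewrite set0U.
move=> nd; have [x xR dx] : exists2 x, x \in R & #|[set w in R | e x w]| <= 1.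
  apply: NNPP => no; apply: nd => v vR; rewrite ltnNge; apply/negP => dv.
  by apply: no; exists v.
have key C f0 : C \subset R -> x \in C -> covering C f0 [set x] ->
    (forall w, w \in R -> e x w -> w \in C) ->
    exists f I, [/\ covering R f I, I \subset R & independent e I].
  move=> CR xC c0 nbx; have [|f [I [cf IR iI]]] := IH C CR.
    by apply/set0Pn; exists x.
  have nxI w : w \in I -> ~~ e x w.
    move/(subsetP IR); rewrite inE => /andP[wC wR].
    by apply: contra wC; apply: nbx.
  exists (relU f0 f), ([set x] :|: I); rewrite -{1}(unC C CR); split.
  - exact: cover_union.
  - by rewrite subUset sub1set xR (subset_trans IR (subsetDl _ _)).
  apply/independentP => u v; rewrite !inE => /orP[/eqP->|uI] /orP[/eqP->|vI].
  - by rewrite e_irr.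
  - exact: nxI.
  - by rewrite e_sym nxI.
  - by move/independentP: iI; apply.
move: dx; rewrite leq_eqVlt ltnS leqn0 => /orP[/cards1P[y Ny]|/eqP/cards0_eq N0].
  have := set11 y; rewrite -Ny inE => /andP[yR exy].
  apply: (key _ _ _ _ (cover_edge exy)).
  - by rewrite subUset !sub1set xR.
  - by rewrite !inE eqxx.
  - move=> w wR exw; have : w \in [set y] by rewrite -Ny inE wR.
    by rewrite !inE => ->; rewrite orbT.
apply: (key _ _ _ _ (cover_vertex x)); rewrite ?sub1set ?inE //.
by move=> w wR exw; have := in_set0 w; rewrite -N0 inE wR exw.
Qed.

End Cover.

(** * Choice of the full set *)

Section Deficiency.
Variables (T : finType) (e : rel T) (b d m : nat).
Hypotheses (e_sym : symmetric e) (e_irr : irreflexive e) (b_gt2 : 2 < b).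
Hypothesis deg_ge : forall v, d <= deg e v.
Implicit Types (X J K L W : {set T}) (F : rel T).

Local Notation full2 := (full e b (fun=> 2)).
Local Notation near2 := (near e b (fun=> 2)).

Hypothesis full_max : forall X F, full2 X F -> #|X| <= m.

(** This is the gain of [b (d - 1) / 2] in independence number, doubled to avoid fractions; the
    successor on the right amounts to rounding that half down. *)
Definition efficient W := forall J, independent e J -> [disjoint J & W] ->
  exists2 K, independent e K & 2 * #|J| + b * (d - 1) <= (2 * #|K|).+1.

Lemma weaken_deg J K v : 2 * #|J| + b * (deg e v - 1) <= (2 * #|K|).+1 ->
  2 * #|J| + b * (d - 1) <= (2 * #|K|).+1.
Proof. by apply: leq_trans; rewrite leq_add2l leq_mul2l leq_sub2r ?orbT. Qed.

(** A new vertex [w] is hung on [v] by one edge and becomes the deficient vertex; [v] needs room for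
    that edge, either from its own deficiency or below [b]. *)
Lemma near_new X F v w : subgraph_on e X F -> v \in X ->
  (forall u, u \in X -> 2 <= deg F u + (u == v) <= b) ->
  e v w -> w \notin X -> near2 (w |: X) w (add_edge F v w).
Proof.
move=> sub vX dF evw wX; have vw := edge_neq e_irr evw.
have sF : symmetric F by case: sub.
have Fvw : ~~ F v w by case: sub => _ _ FX; apply: contra wX; rewrite sF => /FX.
split.
- apply: subgraph_on_add => //; rewrite ?inE ?eqxx ?vX ?orbT //.
  by case: sub => ? ? FX; split=> // x y /FX xX; rewrite inE xX orbT.
- by rewrite !inE eqxx.
- by rewrite deg_add_edge // (deg_out sub wX) eqxx eq_sym (negbTE vw).
move=> u; rewrite !inE => /orP[->//|uX] uw.
by rewrite deg_add_edge // (negbTE uw) addn0 dF.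
Qed.

(* L is the path of F from t up to, not including, the first vertex u0 of
   degree at least 3; v0 is its last vertex. *)
Lemma hanging_path X F t : near2 X t F -> exists L v0 u0,
  [/\ t \in L, {in L, forall v, deg F v <= 2},
      forall v u, v \in L -> u \notin L -> F v u -> [/\ v = v0, u = u0 & 2 < deg F u]
    & exists F', full2 (X :\: L) F'].
Proof.
move=> [[sF Fe FX] tX [dt] dF].
(* The path is recorded only through its vertex set and the single edge [v0 u0] of [F] leaving it; a
   set of maximum size is then taken. *)
pose hang L v0 u0 := [/\ t \in L, {in L, forall v, deg F v <= 2}, v0 \in L,
  u0 \notin L & F v0 u0 /\
  forall v u, v \in L -> u \notin L -> F v u -> v = v0 /\ u = u0].
pose P n := exists L v0 u0, hang L v0 u0 /\ #|L| = n.
have [||n [L [v0 [u0 [[tL dL v0L u0L [F0 Lout]] cL]]]] nmax] := @ex_max_nat P #|T|.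
- have /cards1P[u Nu] : #|[set y | F t y]| == 1 by rewrite -/(deg F t) dt.
  have Ftu : F t u by have := set11 u; rewrite -Nu inE.
  exists #|[set t]|, [set t], t, u; split=> //; split.
  + by rewrite inE.
  + by move=> v; rewrite inE => /eqP->; rewrite dt.
  + by rewrite inE.
  + by rewrite inE eq_sym (edge_neq e_irr (Fe _ _ Ftu)).
  + split=> // v w; rewrite inE => /eqP-> _ Ftw; split=> //.
    by apply/eqP; rewrite -in_set1 -Nu inE.
- by move=> n [L [_ [_ [_ <-]]]]; apply: max_card.
have u0X : u0 \in X by move: F0; rewrite sF => /FX.
have u0t : u0 != t by apply: contraNneq u0L => ->.
(* If [u0] had degree 2, its other neighbour [y1] would be outside [L], and adding [u0] to [L] would
   give a larger such set, left by [u0 y1]. *)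
have du0 : 2 < deg F u0.
  rewrite ltnNge; apply/negP => du0.
  have : deg F u0 == 2 by rewrite eqn_leq du0; case/andP: (dF u0 u0X u0t).
  rewrite /deg (cardsD1 v0) inE sF F0 eqSS => /cards1P[y1 Ny].
  have [y1v0 Fy1] : y1 != v0 /\ F u0 y1.
    by have := set11 y1; rewrite -Ny !inE => /andP[].
  have y1L : y1 \notin L.
    apply/negP => y1L; rewrite sF in Fy1.
    by have [E _] := Lout y1 u0 y1L u0L Fy1; rewrite E eqxx in y1v0.
  suff : #|u0 |: L| <= n by rewrite cardsU1 u0L cL ltnn.
  apply: nmax; exists (u0 |: L), u0, y1; split=> //; split.
  - by rewrite !inE tL orbT.
  - by move=> v; rewrite !inE => /orP[/eqP->|/dL].
  - by rewrite !inE eqxx.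
  - by rewrite !inE negb_or y1L eq_sym (edge_neq e_irr (Fe _ _ Fy1)).
  split=> // v w; rewrite !inE negb_or => vL /andP[wu0 wL] Fvw.
  case/orP: vL => [/eqP E|vL]; last first.
    by have [_ E] := Lout v w vL wL Fvw; rewrite E eqxx in wu0.
  rewrite {v}E in Fvw *; split=> //; apply/eqP; rewrite -in_set1 -Ny !inE Fvw andbT.
  by apply: contraNneq wL => ->.
exists L, v0, u0; split=> //.
  by move=> v u vL uL Fvu; have [-> E] := Lout v u vL uL Fvu; rewrite E.
pose F' : rel T := fun u v => [&& F u v, u \notin L & v \notin L].
exists F'; split; first split.
- by move=> u v; rewrite /F' sF [(u \notin L) && _]andbC.
- by move=> u v /and3P[/Fe].
- by move=> u v /and3P[/FX uX uL _]; rewrite inE uL.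
move=> v; rewrite inE => /andP[vL vX].
have vt : v != t by apply: contraNneq vL => ->.
have := dF v vX vt.
have dF' : deg F' v <= deg F v.
  by apply: subset_leq_card; apply/subsetP => y; rewrite !inE => /and3P[].
(* Outside [L] only [u0] loses an edge, and only one; its degree was at least 3. *)
suff : deg F v <= deg F' v + (v == u0).
  by move: dF' du0; have [->|_] := eqVneq v u0; clear; lia.
rewrite /deg -(cardsID L) addnC; apply: leq_add.
  by apply: subset_leq_card; apply/subsetP => y; rewrite !inE => /andP[yL Fvy]; rewrite /F' Fvy vL.
have [vu|vu] := eqVneq v u0.
  apply: leq_trans (_ : #|[set v0]| <= _); last by rewrite cards1.
  apply: subset_leq_card; apply/subsetP => y; rewrite !inE sF => /andP[Fyv yL].
  by have [-> _] := Lout y v yL vL Fyv.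
rewrite leqn0 cards_eq0; apply/eqP/setP => y; rewrite !inE sF; apply/negP => /andP[Fyv yL].
by have [_ E] := Lout y v yL vL Fyv; rewrite E eqxx in vu.
Qed.

Lemma near_efficient X0 t0 F0 : near2 X0 t0 F0 -> m < #|X0| ->
  exists W F, full2 W F /\ efficient W.
Proof.
move=> nr0 mX0.
pose P n := exists X t F, near2 X t F /\ #|X| = n.
have [||n [X [t [F [nr cX]]]] nmax] := @ex_max_nat P #|T|.
- by exists #|X0|, X0, t0, F0.
- by move=> n [X [_ [_ [_ <-]]]]; apply: max_card.
have mX : m < #|X|.
  by rewrite cX; apply: leq_trans mX0 _; apply: nmax; exists X0, t0, F0.
have noX v F' : near2 X v F' -> forall w, w \notin X -> ~~ e v w.
  move=> nr' w wX; apply/negP => evw.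
  suff : #|w |: X| <= n by rewrite cardsU1 wX cX ltnn.
  apply: nmax; exists (w |: X), w, (add_edge F' v w); split=> //.
  case: nr' => sub vX [dv] dF; apply: near_new => //.
  move=> u uX; have [->|uv] := eqVneq u v; first by rewrite dv addn1 (ltnW b_gt2).
  by rewrite addn0 dF.
have no_full F' : ~ full2 X F' by move/full_max; rewrite leqNgt mX.
have [L [v0 [u0 [tL dL Lout [F' fF']]]]] := hanging_path nr.
exists (X :\: L), F'; split=> // J iJ dJ.
have [|||K iK cK] := search_independent e_sym e_irr b_gt2 (fun=> leqnn 2) no_full nr
   tL dL Lout _ _ iJ.
- by move=> v w vX vL dv [F1 nr1]; apply: noX nr1 _.
- case: (nr) => _ _ [->] _; rewrite addn1 ltnS leqn0 cards_eq0; apply/eqP/setP => w.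
  by rewrite !inE; apply/negP => /andP[etw /(noX _ _ nr)]; rewrite etw.
- move=> j jJ jX; apply: contraT => jL.
  by have := disjointFr dJ jJ; rewrite inE jX jL.
by exists K => //; apply: weaken_deg cK.
Qed.

Lemma full_efficient W F : full2 W F -> #|W| = m -> W != setT ->
  (forall X t F', near2 X t F' -> #|X| <= m) -> efficient W.
Proof.
move=> fF cW WT near_max.
(* Otherwise a full set in the complement of [W] could be joined to [W], against the maximality of
   [m]. *)
have [x xW dx] : exists2 x, x \notin W & #|[set w in ~: W | e x w]| <= 1.
  apply: NNPP => no.
  have [||C [F' [CW C0 fF']]] := @min_degree2_full _ e b e_sym e_irr b_gt2 (~: W).
  - by apply: contra WT => /eqP W0; rewrite -[W]setCK W0 setC0.
  - move=> v; rewrite inE => vW; rewrite ltnNge; apply/negP => dv.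
    by apply: no; exists v.
  have dC : [disjoint W & C].
    by rewrite disjoint_sym disjoint_subset; apply/subsetP => v /(subsetP CW); rewrite !inE.
  have := full_max (full_union dC fF fF').
  rewrite cardsU (disjoint_setI0 dC) cards0 subn0 cW -[X in _ <= X]addn0 leq_add2l.
  by rewrite leqn0 cards_eq0 (negbTE C0).
have sub : subgraph_on e (x |: W) F.
  by case: fF => -[sF Fe FX] _; split=> // u v /FX uW; rewrite inE uW orbT.
have dFx : deg F x = 0 by case: fF => subW _; apply: deg_out subW xW.
(* x starts with degree 0, so it is deficient by one for the bound 1. *)
pose g v := if v == x then 1 else 2.
have g_le2 v : g v <= 2 by rewrite /g; case: ifP.
have cX : m < #|x |: W| by rewrite cardsU1 xW cW.
have nr : near e b g (x |: W) x F.
  split=> //; first by rewrite !inE eqxx.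
    by rewrite dFx /g eqxx.
  move=> v; rewrite !inE /g => /orP[->//|vW] /negbTE->.
  by case: fF => _; apply.
(* In a full [F'] the vertex [x] has degree 1, giving a near-full set larger than [m], or degree at
   least 2, giving a full set larger than [m]. *)
have no_full F' : ~ full e b g (x |: W) F'.
  case=> sub' dF'; have xX : x \in x |: W by rewrite !inE eqxx.
  have dF2 v : v \in x |: W -> v != x -> 2 <= deg F' v <= b.
    by move=> vX vx; have := dF' v vX; rewrite /g (negbTE vx).
  have := dF' x xX; rewrite /g eqxx => /andP[]; rewrite leq_eqVlt => /orP[/eqP d1 _|d2 db].
    suff : #|x |: W| <= m by rewrite leqNgt cX.
    by apply: (near_max _ x F'); split; rewrite -?d1.
  suff : #|x |: W| <= m by rewrite leqNgt cX.
  apply: (@full_max _ F'); split=> // v vX; have [->|] := eqVneq v x; first by rewrite d2.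
  exact: dF2.
move=> J iJ dJ.
have [||||||K iK cK] := @search_independent _ e b g _ e_sym e_irr b_gt2 g_le2 x F no_full nr
  [set x] J x x _ _ _ _ _ iJ.
- by rewrite inE.
- by move=> v; rewrite inE => /eqP->; rewrite dFx.
- move=> v u; rewrite inE => /eqP-> _ Fxu.
  by have := cards0_eq dFx => /setP/(_ u); rewrite !inE Fxu.
(* As [v] has degree 2 and [b] exceeds 2, hanging [w] on [v] would make [w |: W] near-full of size
   [m + 1]. *)
- move=> v w vX; rewrite inE => vx dv _ wX; apply/negP => evw.
  have vW : v \in W by move: vX; rewrite !inE (negbTE vx).
  have wW : w \notin W by apply: contra wX; rewrite inE orbC => ->.
  suff : #|w |: W| <= m by rewrite cardsU1 wW cW ltnn.
  case: fF => subW dF.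
  apply: (near_max _ w (add_edge F v w)); apply: near_new => // u uW.
  have [->|_] := eqVneq u v; last by rewrite addn0 dF.
  have /andP[d2 _] := dF v vW.
  by rewrite addn1 leqW //= (leq_ltn_trans dv).
- rewrite dFx addn0; apply: leq_trans dx; apply: subset_leq_card.
  by apply/subsetP => w; rewrite !inE negb_or => /and3P[-> _ ->].
- move=> j jJ; rewrite !inE => /orP[//|jW].
  by have := disjointFr dJ jJ; rewrite jW.
by exists K => //; apply: weaken_deg cK.
Qed.

End Deficiency.

Section Main.
Variables (T : finType) (e : rel T) (b d : nat).
Hypotheses (e_sym : symmetric e) (e_irr : irreflexive e) (b_gt2 : 2 < b).
Hypothesis deg_ge : forall v, d <= deg e v.

Lemma efficient_exists :
  exists W F, full e b (fun=> 2) W F /\ (W = setT \/ efficient e b d W).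
Proof.
pose P n := exists W F, full e b (fun=> 2) W F /\ #|W| = n.
have [||m [W [F [fF cW]]] mmax] := @ex_max_nat P #|T|.
- exists 0, set0, (fun _ _ => false); split; last by rewrite cards0.
  by split=> // v; rewrite inE.
- by move=> n [W [_ [_ <-]]]; apply: max_card.
have full_max X F' : full e b (fun=> 2) X F' -> #|X| <= m.
  by move=> fF'; apply: mmax; exists X, F'.
have [WT|WT] := eqVneq W setT; first by exists W, F; split=> //; left.
have [[X [t [F' [nr mX]]]]|no] := classic (exists X t F',
    near e b (fun=> 2) X t F' /\ m < #|X|).
  have [W' [F1 [fF1 effW]]] := near_efficient e_sym e_irr b_gt2 deg_ge full_max nr mX.
  by exists W', F1; split=> //; right.
exists W, F; split=> //; right.
apply: (full_efficient e_sym e_irr b_gt2 deg_ge full_max fF cW WT) => X t F' nr.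
by rewrite leqNgt; apply/negP => mX; apply: no; exists X, t, F'.
Qed.

End Main.

(** * Components *)

Section Components.
Variables (T : finType) (f : rel T).
Hypothesis f_sym : symmetric f.

Lemma connect_equivalence : {in [set: T] & &, equivalence_rel (connect f)}.
Proof.
move=> u v w _ _ _; split=> // uv; apply: same_connect => //.
exact: sym_connect_sym.
Qed.

Lemma component_eq (C : {set T}) x : C \in components f -> x \in C ->
  C = [set y | connect f x y].
Proof.
move=> CP xC; have /and3P[_ tI _] := equivalence_partitionP connect_equivalence.
apply/setP => y; rewrite inE -(pblock_equivalence_partition connect_equivalence) ?inE //.
by rewrite -/(components f) (def_pblock tI CP xC).
Qed.

Lemma component_deg (C : {set T}) x : C \in components f -> x \in C ->
  degree_in f C x = deg f x.
Proof.
move=> CP xC; apply: eq_card => y; rewrite !inE (component_eq CP xC) inE.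
by case fxy: (f x y); rewrite ?andbF // (connect1 fxy).
Qed.

Lemma component_card_gt (C : {set T}) x : irreflexive f -> C \in components f ->
  x \in C -> deg f x < #|C|.
Proof.
move=> f_irr CP xC; rewrite -(component_deg CP xC) (cardsD1 x C) xC ltnS.
apply: subset_leq_card; apply/subsetP => y; rewrite !inE => /andP[-> fxy].
by rewrite (eq_sym y) (edge_neq f_irr fxy).
Qed.

Lemma in_trivial_component I (C : {set T}) v : C \in components f -> v \in C ->
  in_trivial f I v -> #|C| <= 2 /\ exists2 p, p \in I & p \in C.
Proof.
move=> CP vC [p [q [pI vpq pq cl]]].
have cpq : connect f p q.
  by case/orP: pq => [/eqP->|/connect1//]; rewrite connect0.
have pC : p \in C.
  rewrite (component_eq CP vC) inE; case/orP: vpq => /eqP->; first exact: connect0.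
  by rewrite (sym_connect_sym f_sym).
split; last by exists p.
apply: leq_trans (_ : #|[set p; q]| <= 2); last by rewrite cards2; case: (p != q).
apply: subset_leq_card; apply/subsetP => y; rewrite (component_eq CP pC) inE => py.
have clo : closed f [set p; q].
  apply: (intro_closed (sym_connect_sym f_sym)) => u w fuw; rewrite !inE.
  case/orP => /eqP E; rewrite {u}E in fuw.
    by have [/(_ fuw)-> _] := cl w; rewrite eqxx orbT.
  by have [_ /(_ fuw)->] := cl w; rewrite eqxx.
by rewrite -(closed_connect clo py) !inE eqxx.
Qed.

(** Sending each vertex of [I] to its component reaches every trivial component: a vertex of degree
    at least 2 lies in a component of at least three vertices, so the vertices of a trivial one
    satisfy [in_trivial]. *)
Lemma trivial_components_le e b (I : {set T}) : irreflexive e ->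
  covering e b setT f I -> #|trivial_components f| <= #|I|.
Proof.
move=> e_irr [[_ fe _] cf].
have f_irr : irreflexive f by move=> x; apply/negP => /fe; rewrite e_irr.
apply: leq_trans (leq_imset_card (pblock (components f)) I).
apply: subset_leq_card; apply/subsetP => C; rewrite inE => /andP[CP C2].
have /and3P[_ tI nC] := equivalence_partitionP connect_equivalence.
have /set0Pn[v vC] : C != set0 by apply: contraNneq nC => <-.
case: (cf v (in_setT v)) => [/andP[d2 _]|tv].
  by have := leq_trans (component_card_gt f_irr CP vC) C2; rewrite ltnS leqNgt d2.
have [_ [p pI pC]] := in_trivial_component CP vC tv.
by apply/imsetP; exists p => //; rewrite (def_pblock tI CP pC).
Qed.

Lemma cover_pseudo_factor e b (I : {set T}) : simple_graph e ->
  covering e b setT f I -> pseudo_2b_factor b e f.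
Proof.
move=> [_ e_irr] [[_ fe _] cf]; split.
  by split=> //; split=> // x; apply/negP => /fe; rewrite e_irr.
move=> C CP C3 x xC; rewrite (component_deg CP xC).
case: (cf x (in_setT x)) => // tx.
by have [] := in_trivial_component CP xC tx; rewrite leqNgt C3.
Qed.

End Components.

(** * Assembling the factor and counting its trivial components *)

Theorem theorem1 (b : nat) (T : finType) (e : rel T)
  (hb : 4 <= b)
  (hG : simple_graph e)
  (hdelta : 1 <= min_degree e)
  (halpha : b * (min_degree e - 1) < 2 * independence_number e) :
  exists f : rel T,
    pseudo_2b_factor b e f /\
    #|trivial_components f|
      <= independence_number e - (b * (min_degree e - 1)) %/ 2.
Proof.
have [e_sym e_irr] := hG; have b_gt2 : 2 < b by apply: ltnW.
have deg_ge v : min_degree e <= deg e v.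
  have <- : degree e v = deg e v by apply: eq_card => y; rewrite !inE.
  rewrite /min_degree; elim: (index_enum T) (mem_index_enum v) => //= u r IHr.
  rewrite big_cons inE => /orP[/eqP->|/IHr]; first exact: geq_minl.
  exact: leq_trans (geq_minr _ _).
have [W [F [fF effW]]] := efficient_exists e_sym e_irr b_gt2 deg_ge.
have [f [I [cf IW iI]]] := cover_exists e_sym e_irr b_gt2 (~: W).
have dW : [disjoint I & W].
  rewrite disjoint_subset; apply: subset_trans IW _.
  by apply/subsetP => v; rewrite !inE.
have cov : covering e b setT (relU F f) (set0 :|: I).
  rewrite -(setUCr W); apply: cover_union cf => //; last exact: full_cover.
  by rewrite disjoint_subset; apply/subsetP => v; rewrite !inE negbK.
have sFf : symmetric (relU F f) by case: cov => -[].
exists (relU F f); split; first exact: cover_pseudo_factor cov.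
apply: leq_trans (trivial_components_le sFf e_irr cov) _; rewrite set0U.
(* When [W] is the whole vertex set, [I] is empty and the bound is the hypothesis on the
   independence number. *)
have bound : 2 * #|I| + b * (min_degree e - 1) <= (2 * independence_number e).+1.
  case: effW => [WT|effW].
    move: IW; rewrite WT setCT subset0 => /eqP->; rewrite cards0 muln0.
    exact: leqW (ltnW halpha).
  have [K iK cK] := effW I iI dW.
  by apply: leq_trans cK _; rewrite ltnS leq_mul2l /independence_number leq_bigmax_cond.
by move: bound; clear; move: (b * _) => N; lia.
Qed.
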